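(* Let $p$ be a prime, $n\ge 1$, $f\in\mathbb{Z}[x]$, and let $C$ be a cycle of size $k$ in $G(f,\mathbb{Z}_{p^n})$ with multiplier $\lambda=\lambda(C)$ and $\bar\lambda$ its image in $\mathbb{Z}_p$. Consider the lifted graph of $C$ in $G(f,\mathbb{Z}_{p^{n+1}})$. (1) If $\bar\lambda=0$, then the lifted graph of $C$ contains exactly one cycle, and it has size $k$. (2) If $\bar\lambda=1$, then the lifted graph of $C$ consists of only one cycle of size $kp$, or of $p$ cycles of size $k$; the latter case occurs if and only if $r_v=0$ for a vertex $v$ of $C$. (3) If $\bar\lambda\ne 0,1$, then the lifted graph of $C$ consists of one cycle of size $k$ and $(p-1)/m$ cycles of size $mk$, where $m$ is the multiplicative order of $\bar\lambda$ in $\mathbb{Z}_p^\times$ (the least positive integer with $\bar\lambda^m=1$).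
   Context: $\mathbb{Z}_N:=\mathbb{Z}/N\mathbb{Z}$; $f$ is regarded as a function on each $\mathbb{Z}_N$, and $f^i$ denotes the $i$-th iterate. The functional graph $G(f,\mathbb{Z}_N)$ has vertex set $\mathbb{Z}_N$ and directed edges $(v,f(v))$. A cycle of size $k$ is a set of $k$ distinct vertices $v_0,\dots,v_{k-1}$ with $f(v_i)=v_{i+1}$ (indices mod $k$). Lifted graph: for $n'>n$ let $\pi:\mathbb{Z}_{p^{n'}}\to\mathbb{Z}_{p^n}$ be the natural projection; for a subgraph $S$ of $G(f,\mathbb{Z}_{p^n})$ with vertex set $V$, the lifted graph of $S$ in $G(f,\mathbb{Z}_{p^{n'}})$ is the subgraph of $G(f,\mathbb{Z}_{p^{n'}})$ induced on $\pi^{-1}(V)$; a lifted cycle of $S$ is a cycle in this lifted graph. Multiplier: for a cycle $C=\{v_0,\dots,v_{k-1}\}$ of size $k$, $\lambda(C):=(f^k)'(v_0)=\prod_{v\in C}f'(v)$ (derivatives of the integer polynomials, evaluated at representatives), and $\bar\lambda(C)$ is its image in $\mathbb{Z}_p$ (independent of choices). For a vertex $v$ of a cycle $C$ of size $k$ in $G(f,\mathbb{Z}_{p^n})$, let $a_v\in[0,p^n)$ be the unique representative of $v$ and define $r_v\in[0,p)$ as the remainder of the integer $(f^k(a_v)-a_v)/p^n$ upon division by $p$; equivalently $f^k(a_v)\equiv a_v+r_vp^n \pmod{p^{n+1}}$. *)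

(* Defs.v *)
From HB Require Import structures.
From mathcomp Require Import all_boot all_order all_algebra.

Set Implicit Arguments.
Unset Strict Implicit.
Unset Printing Implicit Defensive.

Import Order.TTheory GRing.Theory Num.Theory.
Local Open Scope ring_scope.

Section Digraphs.

Variable T : finType.
Implicit Types (e : rel T) (V D : {set T}) (k : nat).

Definition cycle_of_size e k D : bool :=
  (0 < k)%N && [exists s : k.-tuple T, ucycleb e s && (D == [set x in s])].

Definition cycles e : {set {set T}} := [set D : {set T} | cycle_of_size e #|D| D].

(* The edges of the subgraph induced on V; vertices outside V are isolated and
   loopless, hence lie on no cycle. *)
Definition induced V e : rel T := [rel x y | [&& x \in V, y \in V & e x y]].

(* The cycles of e partition the vertex set V, and their sizes, counted with
   multiplicity, are those listed in sizes. *)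
Definition consists_of_cycles V e (sizes : seq nat) : Prop :=
  partition (cycles e) V /\ perm_eq [seq #|D : {set T}| | D <- enum (cycles e)] sizes.

End Digraphs.

(* 'Z_N is the ring of integers modulo N only for 1 < N. *)

Definition modfun (f : {poly int}) (N : nat) : 'Z_N -> 'Z_N :=
  fun v => (map_poly intr f).[v].

Definition functional_graph (f : {poly int}) (N : nat) : rel 'Z_N :=
  frel (@modfun f N).

(* The natural projection when N divides M. *)
Definition Zproj (M N : nat) (x : 'Z_M) : 'Z_N := (x : nat)%:R.

Definition lifted_vertices (M N : nat) (V : {set 'Z_N}) : {set 'Z_M} :=
  [set x | Zproj N x \in V].

Definition lifted_graph (f : {poly int}) (M N : nat) (V : {set 'Z_N}) :
    rel 'Z_M :=
  induced (lifted_vertices M V) (functional_graph f (N := M)).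

Definition Zrep (N : nat) (v : 'Z_N) : int := (v : nat)%:Z.

Definition poly_iter (f : {poly int}) (i : nat) : {poly int} :=
  iter i (fun q => f \Po q) 'X.

(* The multiplier of a cycle of size k, computed at its vertex v. *)
Definition multiplier (f : {poly int}) (N k : nat) (v : 'Z_N) : int :=
  (poly_iter f k)^`().[Zrep v].

(* The division by p ^ n is exact when v lies on a cycle of size k. *)
Definition cycle_rem (f : {poly int}) (p n k : nat) (v : 'Z_(p ^ n)) : int :=
  ((((poly_iter f k).[Zrep v] - Zrep v) %/ (p ^ n)%N%:Z)%Z %% p%:Z)%Z.

Arguments cycle_rem f p n k v : clear implicits.

Lemma poly_iter_modfun (f : {poly int}) (N i : nat) (v : 'Z_N) :
  ((poly_iter f i).[Zrep v])%:~R = iter i (@modfun f N) v.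
Proof.
elim: i => [|i IHi] /=; first by rewrite hornerX /Zrep -pmulrn natr_Zp.
by rewrite horner_comp -IHi /modfun horner_map.
Qed.

(* The multiplier does not depend on the chosen vertex modulo N, as it is the
   product of the values of f' along the cycle. *)
Lemma multiplier_prod (f : {poly int}) (N k : nat) (C : {set 'Z_N}) (v : 'Z_N) :
  cycle_of_size (functional_graph f (N := N)) k C -> v \in C ->
  (multiplier f k v)%:~R = \prod_(w in C) @modfun f^`() N w.
Proof.
case/andP=> k_gt0 /existsP[s /andP[/andP[cyc uniqs] /eqP->]]; rewrite inE => vs.
have chain i : ((poly_iter f i)^`().[Zrep v])%:~R
    = \prod_(j < i) @modfun f^`() N (iter j (@modfun f N) v).
  elim: i => [|i IHi]; first by rewrite big_ord0 derivX hornerC.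
  rewrite big_ord_recr -IHi /= deriv_comp hornerM rmorphM /= mulrC.
  by rewrite horner_comp -poly_iter_modfun [in RHS]/modfun horner_map.
rewrite /multiplier chain.
rewrite (eq_bigl (fun w => w \in (s : seq _))); last by move=> w; rewrite inE.
have [j s' rots] := rot_to vs.
have cyc' : fcycle (@modfun f N) (v :: s') by rewrite -rots rot_cycle.
have szs' : (size s').+1 = k.
  by rewrite -(size_tuple s) -(size_rot j s) rots.
have def_s : v :: s' = traject (@modfun f N) v k.
  move: cyc' szs'; rewrite /= rcons_path => /andP[/fpathP[m ->] _].
  by rewrite size_traject => <-.
rewrite (eq_bigl (fun w => w \in v :: s')); last first.
  by move=> w; rewrite -rots mem_rot.
rewrite -big_uniq; last by rewrite -rots rot_uniq.
rewrite def_s -(big_mkord xpredT (fun j => @modfun f^`() N (iter j _ v))).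
rewrite (big_nth v) size_traject !big_mkord; apply: eq_bigr => i _.
by rewrite nth_traject.
Qed.

(* Main.v *)
(* Write the points of Z_(p ^ n.+1) above a vertex w of C as w + t p^n with t in
   F_p.  By Taylor expansion, the k-th iterate of f acts on them by the affine
   map t |-> r_w + lambda t, and it is the first return map to this fiber.
   Intersecting with the fiber is therefore a bijection from the cycles of the
   lifted graph to those of the affine map, and divides their sizes by k.  If
   lambda != 0, all these affine maps, one for each w, are bijective, so every
   lifted vertex lies on a cycle; if moreover lambda != 1, the affine map is
   conjugate by a translation to multiplication by lambda. *)
Require Import Defs.
From HB Require Import structures.
From mathcomp Require Import all_boot all_order all_algebra.
From mathcomp Require Import ring finfield.

Set Implicit Arguments.
Unset Strict Implicit.
Unset Printing Implicit Defensive.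

Import Order.TTheory GRing.Theory Num.Theory.

(** * Periodic points of a self-map and the cycles of its graph *)

Section PeriodicPoints.

Variables (T : finType) (f : T -> T).
Implicit Types (x y : T) (V D : {set T}) (n k : nat).

(** Starting from [f x] forces a positive number of steps, since [fconnect] is reflexive. *)
Definition periodic x : bool := fconnect f (f x) x.

Definition forbit x : {set T} := [set y | fconnect f x y].

Lemma periodicP x : reflect (exists n, iter n.+1 f x = x) (periodic x).
Proof. by rewrite /periodic fconnect_f; apply: (iffP idP) => /(orbitPcycle 0 3). Qed.

Lemma periodic_iter x n : periodic x -> periodic (iter n f x).
Proof.
move/periodicP=> [j xj]; apply/periodicP; exists j.
by rewrite -iterD addnC iterD xj.
Qed.

Lemma iter_closed V x n : {homo f : x / x \in V} -> x \in V -> iter n f x \in V.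
Proof. by move=> fV Vx; elim: n => //= n; apply: fV. Qed.

Lemma fconnectP x y : reflect (exists n, iter n f x = y) (fconnect f x y).
Proof.
apply: (iffP idP) => [/iter_findex<-|[n <-]]; last exact: fconnect_iter.
by exists (findex f x y).
Qed.

Lemma forbit_periodic x y : periodic x -> y \in forbit x -> forbit y = forbit x.
Proof.
move=> /periodicP[j xj]; rewrite inE => xy.
have yx : fconnect f y x.
  have /fconnectP[i <-] := xy.
  have fix_x q : iter (q * j.+1) f x = x by elim: q => // q IHq; rewrite mulSn iterD IHq.
  (* With [y] reached from [x] in [i] steps, [i * j] more steps complete [i] full turns of length
     [j.+1]. *)
  by apply/fconnectP; exists (i * j); rewrite -iterD addnC -mulnS fix_x.
by apply/setP=> z; rewrite !inE; apply/idP/idP; apply: connect_trans.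
Qed.

Lemma card_forbit x : #|forbit x| = order f x.
Proof. by rewrite cardsE. Qed.

(** Full turns fix [x], so only the remainder of [n] modulo the order matters. A remainder below the
    order is the [findex] of the point it reaches, hence is 0 if that point is [x]. *)
Lemma periodic_order_dvd x n :
  periodic x -> (order f x %| n)%N = (iter n f x == x).
Proof.
rewrite /periodic fconnect_f => cyc; have xo := in_orbit f x.
rewrite [in iter n](divn_eq n (order f x)) addnC iterD.
have -> : iter (n %/ order f x * order f x) f x = x.
  by elim: (n %/ _)%N => // q IHq; rewrite mulSn iterD IHq (iter_order_cycle cyc).
rewrite /dvdn; have := ltn_pmod n (order_gt0 f x); move: (n %% _)%N => r lt_r.
apply/eqP/eqP => [-> //|fix_r].
by rewrite -(findex_iter lt_r) fix_r findex0.
Qed.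

Lemma cycle_of_size_orbit k D x :
    cycle_of_size (frel f) k D -> x \in D ->
  [/\ periodic x, D = forbit x & order f x = k].
Proof.
case/andP=> _ /existsP[s /andP[/andP[cyc us] /eqP->]]; rewrite inE => sx.
split.
- by rewrite /periodic fconnect_f (cycle_orbit_cycle cyc).
- by apply/setP=> y; rewrite !inE (fconnect_cycle cyc).
- by rewrite (order_cycle cyc) // size_tuple.
Qed.

(** Replaces cycles given by tuples with orbits of periodic points. Closure of [V] keeps such an
    orbit inside [V], so its edges survive in the induced graph. *)
Lemma cyclesP V D :
    {homo f : x / x \in V} ->
  reflect (exists x, [/\ x \in V, periodic x & D = forbit x])
          (D \in cycles (induced V (frel f))).
Proof.
move=> fV; rewrite inE; apply: (iffP idP) => [cycD|[x [Vx perx ->]]].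
  have /andP[/card_gt0P[x Dx] /existsP[s /andP[/andP[cyc us] /eqP def_D]]] := cycD.
  have sx : x \in (s : seq T) by rewrite def_D inE in Dx.
  exists x; have /and3P[Vx _ _] := next_cycle cyc sx.
  have cycf : cycle_of_size (frel f) #|D| D.
    rewrite /cycle_of_size (cardD1 x) Dx -[true + _]/(1 + _)%N add1n /=.
    have szs : #|[predD1 D & x]|.+1 = #|D| by rewrite [RHS](cardD1 x) Dx.
    rewrite szs; apply/existsP; exists s; rewrite /ucycleb us andbT -def_D eqxx andbT.
    by apply: sub_cycle cyc => y z /and3P[].
  by split=> //; case: (cycle_of_size_orbit cycf Dx).
rewrite /cycle_of_size card_forbit order_gt0; apply/existsP.
have sz : size (orbit f x) == order f x by rewrite size_orbit.
exists (Tuple sz); rewrite /ucycleb /= orbit_uniq andbT.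
apply/andP; split; last first.
  by apply/eqP/setP=> y; rewrite !inE fconnect_orbit.
have VO : {in orbit f x, forall y, y \in V}.
  by move=> y; rewrite -fconnect_orbit => /fconnectP[n <-]; apply: iter_closed.
rewrite (@sub_in_cycle _ (mem V) (frel f)) //; last by rewrite -fconnect_f.
  by move=> y z Vy Vz fyz; apply/and3P.
by apply/allP.
Qed.

(** Between periodic points [fconnect] is symmetric, hence an equivalence relation, and its classes
    in [V] are the cycles. *)
Lemma partition_cycles V :
    {homo f : x / x \in V} -> {in V, forall x, periodic x} ->
  partition (cycles (induced V (frel f))) V.
Proof.
move=> fV perV.
have eqV : {in V & &, equivalence_rel (fconnect f)}.
  move=> x y z Vx Vy Vz; split=> // xy.
  have oxy : forbit y = forbit x by apply: forbit_periodic; rewrite ?perV // inE.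
  by have /setP/(_ z) := oxy; rewrite !inE.
suff -> : cycles (induced V (frel f)) = equivalence_partition (fconnect f) V.
  exact: equivalence_partitionP.
have VI x : x \in V -> [set y in V | fconnect f x y] = forbit x.
  move=> Vx; apply/setP=> y; rewrite !inE andb_idl // => /fconnectP[n <-].
  exact: iter_closed.
apply/setP=> D; apply/cyclesP/imsetP => // [[x [Vx _ ->]]|[x Vx ->]].
  by exists x; rewrite ?VI.
by exists x; rewrite VI ?perV.
Qed.

End PeriodicPoints.

Lemma closedT (T : finType) (f : T -> T) : {homo f : x / x \in [set: T]}.
Proof. by move=> x _; rewrite inE. Qed.

(** The list is in enumeration order; [consists_of_cycles] compares it only up to permutation. *)
Definition cycle_sizes (T : finType) (e : rel T) : seq nat :=
  [seq #|D : {set T}| | D <- enum (cycles e)].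

(** * Cycles of a map and of its first return map to a fiber *)

Section FirstReturn.

Variables (T S : finType) (F : T -> T) (V : {set T}) (g : S -> S) (psi : S -> T).
Variable k : nat.
Hypotheses (k_gt0 : (0 < k)%N) (FV : {homo F : x / x \in V}).
Hypotheses (psi_inj : injective psi) (psiV : forall t, psi t \in V).
Hypothesis iter_psi : forall t, iter k F (psi t) = psi (g t).
Hypothesis return_dvd : forall i t u, iter i F (psi t) = psi u -> (k %| i)%N.
Hypothesis reach_psi : forall x, x \in V -> exists i t, iter i F x = psi t.

Lemma iter_psi_mul q t : iter (q * k) F (psi t) = psi (iter q g t).
Proof. by elim: q => // q IHq; rewrite mulSn iterD IHq iter_psi. Qed.

(** An orbit can be in the fiber only at times [q * k], and at those times it follows [g]. *)
Lemma forbit_psi t : psi @^-1: forbit F (psi t) = forbit g t.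
Proof.
apply/setP=> u; rewrite !inE; apply/fconnectP/fconnectP => [[i Fi]|[q <-]].
  have /dvdnP[q def_i] := return_dvd Fi.
  by exists q; apply: psi_inj; rewrite -iter_psi_mul -def_i.
by exists (q * k)%N; rewrite iter_psi_mul.
Qed.

Lemma periodic_psi t : periodic F (psi t) = periodic g t.
Proof.
apply/periodicP/periodicP=> [[i Fi]|[q gq]].
  have /dvdnP[[|q] def_i] := return_dvd Fi; first by rewrite mul0n in def_i.
  by exists q; apply: psi_inj; rewrite -iter_psi_mul -def_i.
exists (q.+1 * k).-1; rewrite prednK ?muln_gt0 //.
by rewrite iter_psi_mul gq.
Qed.

Lemma order_psi t : periodic g t -> order F (psi t) = (k * order g t)%N.
Proof.
move=> pert; have perF : periodic F (psi t) by rewrite periodic_psi.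
apply/eqP; rewrite eqn_dvd; apply/andP; split.
  rewrite periodic_order_dvd // mulnC iter_psi_mul.
  by rewrite (inj_eq psi_inj) -periodic_order_dvd.
have fixF : iter (order F (psi t)) F (psi t) = psi t.
  by apply/eqP; rewrite -periodic_order_dvd.
have /dvdnP[q def_o] := return_dvd fixF.
rewrite def_o mulnC dvdn_pmul2r // periodic_order_dvd // -(inj_eq psi_inj).
by rewrite -iter_psi_mul -def_o fixF.
Qed.

(** By [reach_psi] every cycle in [V] meets the fiber, so a base point can be chosen there. *)
Lemma return_cyclesP D :
  reflect (exists2 t, periodic g t & D = forbit F (psi t))
          (D \in cycles (induced V (frel F))).
Proof.
apply: (iffP (cyclesP _ FV)) => [[x [Vx perx ->]]|[t pert ->]]; last first.
  by exists (psi t); rewrite psiV periodic_psi.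
have [i [t def_t]] := reach_psi Vx; exists t.
  by rewrite -periodic_psi -def_t periodic_iter.
by rewrite -def_t (forbit_periodic perx) // inE fconnect_iter.
Qed.

(** Taking the preimage under [psi] is a bijection between the two sets of cycles, and it divides
    sizes by [k]. *)
Lemma perm_cycle_sizes :
  perm_eq (cycle_sizes (induced V (frel F)))
          [seq (k * d)%N | d <- cycle_sizes (induced [set: S] (frel g))].
Proof.
set L := induced V _; set L' := induced _ _.
pose h (D : {set T}) := psi @^-1: D.
have h_inj : {in cycles L &, injective h}.
  move=> D1 D2 /return_cyclesP[t1 per1 ->] /return_cyclesP[t2 per2 ->].
  (* Two cycles with the same trace on the fiber share the point [psi t2], hence coincide. *)
  rewrite /h !forbit_psi => o12; apply/esym/forbit_periodic.
    by rewrite periodic_psi.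
  by have /setP/(_ t2) := forbit_psi t1; rewrite o12 !inE connect0.
have hE : cycles L' = h @: cycles L.
  apply/setP=> E; apply/(cyclesP _ (@closedT _ g))/imsetP.
    case=> t [_ pert ->]; exists (forbit F (psi t)); last by rewrite /h forbit_psi.
    by apply/return_cyclesP; exists t.
  case=> _ /return_cyclesP[t pert ->] ->; exists t.
  by rewrite /h forbit_psi inE.
have cardh : {in cycles L, forall D : {set T}, #|D| = (k * #|h D|)%N}.
  move=> _ /return_cyclesP[t pert ->].
  by rewrite /h forbit_psi !card_forbit order_psi.
have permE : perm_eq (enum (cycles L')) (map h (enum (cycles L))).
  apply: uniq_perm; rewrite ?enum_uniq //.
    by rewrite map_inj_in_uniq ?enum_uniq // => D1 D2; rewrite !mem_enum; apply: h_inj.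
  move=> E; rewrite mem_enum hE; apply/imsetP/mapP => [] [D D_in ->];
    by exists D; rewrite // ?mem_enum // -mem_enum.
rewrite perm_sym; apply: perm_trans (perm_map _ (perm_map _ permE)) _.
apply/permP=> a; congr (count a _); rewrite -!map_comp.
by apply/eq_in_map=> D; rewrite mem_enum => /cardh /= ->.
Qed.

End FirstReturn.

(** * Cycle sizes of maps with prescribed periods *)

Section CycleSizes.

Variables (S : finType) (g : S -> S).
Local Notation Lg := (induced [set: S] (frel g)).

Lemma order_eq d t :
    (0 < d)%N -> (forall i, (iter i g t == t) = (d %| i)%N) ->
  periodic g t /\ order g t = d.
Proof.
move=> d_gt0 fixE; have pert : periodic g t.
  by apply/periodicP; exists d.-1; apply/eqP; rewrite prednK // fixE.
split=> //; apply/eqP; rewrite eqn_dvd periodic_order_dvd // fixE dvdnn /=.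
by rewrite -fixE -periodic_order_dvd.
Qed.

Lemma cycle_sizes_const r : (forall t, g t = r) -> cycle_sizes Lg = [:: 1%N].
Proof.
move=> gr; have forbit_r : forbit g r = [set r].
  apply/setP=> u; rewrite !inE; apply/fconnectP/eqP => [[i <-]|->]; last by exists 0.
  by case: i => //= i; rewrite gr.
rewrite /cycle_sizes; suff -> : cycles Lg = [set [set r]] by rewrite enum_set1 /= cards1.
apply/setP=> D; rewrite in_set1; apply/(cyclesP _ (@closedT _ g))/eqP => [[t [_ pert ->]]|->].
  have [i def_t] := periodicP _ _ pert.
  by rewrite -def_t /= gr.
by exists r; rewrite inE forbit_r; split=> //; apply/periodicP; exists 0.
Qed.

(** All points have order [d], so the cycles cut [S] into blocks of size [d] and the division is
    exact. *)
Lemma cycle_sizes_uniform d :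
    (0 < d)%N -> (forall t i, (iter i g t == t) = (d %| i)%N) ->
  cycle_sizes Lg = nseq (#|S| %/ d) d.
Proof.
move=> d_gt0 fixE.
have cardD : {in cycles Lg, forall D : {set S}, #|D| = d}.
  move=> D /(cyclesP _ (@closedT _ g))[t [_ _ ->]].
  by rewrite card_forbit; have [] := order_eq d_gt0 (fixE t).
have part : partition (cycles Lg) [set: S].
  apply: partition_cycles => [|t _]; first exact: closedT.
  by have [] := order_eq d_gt0 (fixE t).
rewrite -cardsT (card_uniform_partition cardD part) mulnK // cardE.
rewrite -(size_map (fun D : {set S} => #|D|)); apply/all_pred1P/allP=> _ /mapP[D D_in ->].
by rewrite /= cardD // -mem_enum.
Qed.

(** The fixed point is a cycle by itself; the other cycles partition the remaining [#|S|.-1] points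
    into blocks of size [d]. *)
Lemma cycle_sizes_fixpoint t0 d :
    (0 < d)%N -> g t0 = t0 ->
    (forall t i, t != t0 -> (iter i g t == t) = (d %| i)%N) ->
  perm_eq (cycle_sizes Lg) (1%N :: nseq (#|S|.-1 %/ d) d).
Proof.
move=> d_gt0 g0 fixE; have iter0 i : iter i g t0 = t0 by elim: i => //= i ->.
have forbit0 : forbit g t0 = [set t0].
  by apply/setP=> u; rewrite !inE; apply/fconnectP/eqP => [[i <-]|->]; last exists 0.
have per t : periodic g t.
  have [->|nt0] := eqVneq t t0; first by apply/periodicP; exists 0.
  by have [] := order_eq d_gt0 (fun i => fixE t i nt0).
have part : partition (cycles Lg) [set: S].
  by apply: partition_cycles => [|t _]; first exact: closedT.
have P0 : [set t0] \in cycles Lg.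
  by apply/(cyclesP _ (@closedT _ g)); exists t0; rewrite inE.
set P' := cycles Lg :\ [set t0].
have cardD : {in P', forall D : {set S}, #|D| = d}.
  move=> D /setD1P[D0 /(cyclesP _ (@closedT _ g))[t [_ _ def_D]]].
  have nt0 : t != t0 by apply: contraNneq D0 => t_t0; rewrite def_D t_t0 forbit0.
  by rewrite def_D card_forbit; have [] := order_eq d_gt0 (fun i => fixE t i nt0).
have cardS : #|S|.-1 = (#|P'| * d)%N.
  rewrite -cardsT (card_partition part) (big_setD1 _ P0) /= cards1 add1n /=.
  by rewrite (eq_bigr _ cardD) sum_nat_const.
have permP : perm_eq (enum (cycles Lg)) ([set t0] :: enum P').
  apply: uniq_perm; rewrite /= ?enum_uniq ?mem_enum ?setD11 // => D.
  by rewrite inE !mem_enum in_setD1; case: eqP => // ->.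
apply: perm_trans (perm_map _ permP) _; rewrite /= cards1 perm_cons cardS mulnK // cardE.
rewrite -(size_map (fun D : {set S} => #|D|)).
suff /all_pred1P<- : all (pred1 d) [seq #|D : {set S}| | D <- enum P'] by [].
by apply/allP=> _ /mapP[D D_in ->]; rewrite /= cardD // -mem_enum.
Qed.

End CycleSizes.

Local Open Scope ring_scope.

(** * Cycles of affine maps over the prime field *)

Section AffineMaps.

Variables (p : nat) (r l : 'F_p).
Hypothesis p_pr : prime p.
Let g (t : 'F_p) : 'F_p := r + l * t.
Local Notation Lg := (induced [set: 'F_p] (frel g)).

Lemma cycle_sizes_affine0 : l = 0 -> cycle_sizes Lg = [:: 1%N].
Proof. by move=> l0; apply: (cycle_sizes_const (r := r)) => t; rewrite /g l0 mul0r addr0. Qed.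

Lemma iter_translation i t : l = 1 -> iter i g t = t + r *+ i.
Proof.
move=> l1; elim: i => [|i IHi] /=; first by rewrite addr0.
by rewrite IHi /g l1 mul1r mulrS addrCA.
Qed.

Lemma cycle_sizes_translation0 : l = 1 -> r = 0 -> cycle_sizes Lg = nseq p 1%N.
Proof.
move=> l1 r0; rewrite -[in RHS](card_Fp p_pr) -[#|_| in RHS]divn1.
apply: cycle_sizes_uniform => // t i.
by rewrite iter_translation // r0 mul0rn addr0 eqxx dvd1n.
Qed.

Lemma cycle_sizes_translation : l = 1 -> r != 0 -> cycle_sizes Lg = [:: p].
Proof.
move=> l1 r0; have p_gt0 := prime_gt0 p_pr.
rewrite (@cycle_sizes_uniform _ g p) ?card_Fp ?divnn ?p_gt0 // => t i.
(* The point [t] returns after [i] steps iff [r *+ i = 0], that is iff [p] divides [i], as [r] is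
   invertible. *)
rewrite iter_translation // -subr_eq0 addrC addKr -mulr_natr mulf_eq0 (negPf r0) /=.
by rewrite -(dvdn_pcharf (pchar_Fp p_pr)).
Qed.

Lemma cycle_sizes_affine m :
    m.-primitive_root l -> l != 1 ->
  perm_eq (cycle_sizes Lg) (1%N :: nseq (p.-1 %/ m) m).
Proof.
move=> prim l1; have ul : 1 - l != 0 by rewrite subr_eq0 eq_sym.
(* The solution of [t = r + l * t]; measured from it, the map is multiplication by [l]. *)
pose t0 := r / (1 - l).
have g0 : g t0 = t0.
  apply/eqP; rewrite /g -subr_eq0 -addrA -[X in _ + (_ - X)]mul1r -mulrBl -opprB.
  by rewrite mulNr mulrC divfK ?subrr.
have iterE i t : iter i g t - t0 = l ^+ i * (t - t0).
  elim: i => [|i IHi]; first by rewrite mul1r.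
  by rewrite iterS exprS -mulrA -IHi -{1}g0 /g opprD addrACA subrr add0r mulrBr.
rewrite -[in X in _ :: X](card_Fp p_pr).
apply: (cycle_sizes_fixpoint (prim_order_gt0 prim) g0) => t i nt0.
have d0 : t - t0 != 0 by rewrite subr_eq0.
rewrite (prim_order_dvd prim) -(inj_eq (addIr (- t0))) iterE.
by rewrite -[X in _ == X]mul1r (inj_eq (mulIf d0)).
Qed.

End AffineMaps.

(** * Integers modulo N, projections, and Taylor expansion *)

Lemma Zp_intr_eq N (y z : int) :
  (1 < N)%N -> (y%:~R == z%:~R :> 'Z_N) = (N %| y - z)%Z.
Proof.
move=> N_gt1; rewrite -subr_eq0 -rmorphB /=; move: (y - z) => {y}z.
have natE (m : nat) : (m%:R == 0 :> 'Z_N) = (N %| m)%N.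
  by rewrite -(inj_eq val_inj) /= val_Zp_nat.
by case: z => m; rewrite ?NegzE ?mulrNz ?oppr_eq0 ?dvdzN -pmulrn natE.
Qed.

Lemma Zp_intr_Zrep N (x : 'Z_N) : (Zrep x)%:~R = x.
Proof. by rewrite /Zrep -pmulrn natr_Zp. Qed.

(** [Zproj] is defined on the least representative; since [N] divides [M], any other integer
    representative gives the same image. *)
Lemma Zproj_intr M N (z : int) :
  (1 < N)%N -> (1 < M)%N -> (N %| M)%N -> Zproj N (z%:~R : 'Z_M) = z%:~R.
Proof.
move=> N_gt1 M_gt1 NM; set y : 'Z_M := z%:~R.
rewrite -[LHS]/((Zrep y)%:~R); apply/eqP; rewrite Zp_intr_eq //.
by apply: (@dvdz_trans M); rewrite // -Zp_intr_eq // Zp_intr_Zrep.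
Qed.

Lemma modfun_intr f N (z : int) : modfun f (z%:~R : 'Z_N) = (f.[z])%:~R.
Proof. by rewrite /modfun horner_map. Qed.

Lemma Zproj_modfun f M N (x : 'Z_M) :
    (1 < N)%N -> (1 < M)%N -> (N %| M)%N ->
  Zproj N (modfun f x) = modfun f (Zproj N x).
Proof.
move=> N_gt1 M_gt1 NM; rewrite -{1}(Zp_intr_Zrep x) modfun_intr Zproj_intr //.
by rewrite -modfun_intr.
Qed.

(** The remainder coefficient lies in the ring itself, with no division by 2, so the expansion can
    be used over the integers. *)
Lemma horner_taylor2 (R : comNzRingType) (q : {poly R}) (a h : R) :
  exists c, q.[a + h] = q.[a] + q^`().[a] * h + c * h ^+ 2.
Proof.
elim/poly_ind: q => [|q b [c IHq]].
  by exists 0; rewrite deriv0 !horner0 !mul0r !addr0.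
(* The coefficient of [h ^+ 2] when the expansion of [q] is multiplied by [a + h]. *)
exists (c * (a + h) + q^`().[a]).
rewrite derivD derivM derivX derivC addr0 mulr1 !(hornerD, hornerM, hornerX, hornerC) IHq.
by ring.
Qed.

(** * The lifted graph of a cycle and its fibers *)

Section Lifting.

Variables (p n k : nat) (f : {poly int}) (C : {set 'Z_(p ^ n)}).
Hypotheses (p_pr : prime p) (n_gt0 : (1 <= n)%N).
Hypothesis cycC : cycle_of_size (functional_graph f (N := p ^ n)) k C.

Local Notation V := (lifted_vertices (p ^ n.+1) C).
Local Notation L := (lifted_graph f (M := p ^ n.+1) C).
Local Notation F := (@modfun f (p ^ n.+1)).

Implicit Types (w : 'Z_(p ^ n)) (t u : 'F_p) (x : 'Z_(p ^ n.+1)).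

Let p_gt1 : (1 < p)%N := prime_gt1 p_pr.
Let p_gt0 : (0 < p)%N := prime_gt0 p_pr.
Let N_gt1 : (1 < p ^ n)%N. Proof. by rewrite -(exp1n n) ltn_exp2r. Qed.
Let M_gt1 : (1 < p ^ n.+1)%N. Proof. by rewrite -(exp1n n.+1) ltn_exp2r. Qed.
Let NM : (p ^ n %| p ^ n.+1)%N. Proof. by rewrite dvdn_exp2l. Qed.

Lemma Zp_lt N (y : 'Z_N) : (1 < N)%N -> (y < N)%N.
Proof. by move=> N1; rewrite -[X in (_ < X)%N](Zp_cast N1). Qed.

Lemma Fp_lt t : (t < p)%N.
Proof. by rewrite -[X in (_ < X)%N](Fp_cast p_pr). Qed.

Definition lift_point w t : 'Z_(p ^ n.+1) := (w + t * p ^ n)%:R.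

Lemma val_lift_point w t : lift_point w t = (w + t * p ^ n)%N :> nat.
Proof.
rewrite val_Zp_nat // modn_small //.
(* No reduction occurs: [w < p ^ n] and [t < p] keep the sum below [p ^ n.+1]. *)
apply: (@leq_trans (t.+1 * p ^ n)); last by rewrite expnS leq_mul2r Fp_lt orbT.
by rewrite mulSn ltn_add2r Zp_lt.
Qed.

Lemma lift_point_inj w : injective (lift_point w).
Proof.
move=> t u /(congr1 val) /=; rewrite !val_lift_point => /addnI/eqP.
by rewrite eqn_pmul2r ?expn_gt0 ?p_gt0 // => /eqP/val_inj.
Qed.

Lemma Zproj_lift_point w t : Zproj (p ^ n) (lift_point w t) = w.
Proof.
apply: val_inj; rewrite /Zproj /= val_Zp_nat // val_lift_point.
by rewrite addnC modnMDl modn_small // Zp_lt.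
Qed.

Lemma lift_point_surj w x : Zproj (p ^ n) x = w -> exists t, x = lift_point w t.
Proof.
move=> <-; exists (x %/ p ^ n)%:R; apply: val_inj; rewrite /= val_lift_point.
rewrite /Zproj val_Zp_nat // val_Fp_nat // (@modn_small (_ %/ _)); first by rewrite addnC -divn_eq.
by rewrite ltn_divLR ?expn_gt0 ?p_gt0 // -expnS Zp_lt.
Qed.

Lemma Zproj_iter i x : Zproj (p ^ n) (iter i F x) = iter i (@modfun f (p ^ n)) (Zproj (p ^ n) x).
Proof. by elim: i => //= i IHi; rewrite Zproj_modfun // IHi. Qed.

Lemma lifted_closed : {homo F : x / x \in V}.
Proof.
move=> x; rewrite !inE Zproj_modfun // => Cx; have [_ -> _] := cycle_of_size_orbit cycC Cx.
by rewrite inE fconnect1.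
Qed.

Definition fiber_map w t : 'F_p :=
  (cycle_rem f p n k w)%:~R + (multiplier f k w)%:~R * t.

Lemma Fp_intr_eq0 (z : int) : (z%:~R == 0 :> 'F_p) = (p %| z)%Z.
Proof. by rewrite (dvdz_pcharf (pchar_Fp p_pr)). Qed.

(* First-order Taylor expansion at w: the quadratic term is a multiple of
   p ^ (2 n), hence of p ^ n.+1. *)
Lemma iter_lift_point w t :
  w \in C -> iter k F (lift_point w t) = lift_point w (fiber_map w t).
Proof.
move=> Cw; have [perw _ ordw] := cycle_of_size_orbit cycC Cw.
rewrite -poly_iter_modfun /Zrep val_lift_point [RHS]/lift_point pmulrn.
set q := poly_iter f k; move uE: (fiber_map w t) => u; apply/eqP; rewrite Zp_intr_eq //.
have [c] := horner_taylor2 q (Zrep w) (t * p ^ n)%N%:Z.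
rewrite /Zrep -PoszD => ->.
(* As [w] lies on a cycle of size [k], the division in [cycle_rem] is exact; [e] is the quotient
   before reduction modulo [p]. *)
have /dvdzP[e def_q] : ((p ^ n)%N %| q.[Zrep w] - Zrep w)%Z.
  rewrite -Zp_intr_eq // poly_iter_modfun Zp_intr_Zrep.
  by rewrite -periodic_order_dvd // ordw.
have e_mod : (e%:~R : 'F_p) = (cycle_rem f p n k w)%:~R.
  have N0 : (p ^ n)%N%:Z != 0 by rewrite eqz_nat -lt0n expn_gt0 p_gt0.
  apply/eqP; rewrite -subr_eq0 -rmorphB /= Fp_intr_eq0 /cycle_rem -/q def_q mulzK //.
  by rewrite {1}(divz_eq e p) addrK dvdz_mull.
pose l := multiplier f k w.
(* Here [b] is the carry between [e + l * t] and its residue [u]. *)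
have /dvdzP[b def_b] : (p %| e + l * (t : nat)%:Z - (u : nat)%:Z)%Z.
  rewrite -Fp_intr_eq0 rmorphB rmorphD rmorphM /= -!pmulrn !natr_Zp e_mod.
  by rewrite -uE /fiber_map -/l subrr.
have def_qw : q.[Zrep w] = (w : nat)%:Z + e * (p ^ n)%N.
  by rewrite -def_q addrC subrK.
have def_u : (u : nat)%:Z = e + l * (t : nat)%:Z - b * p by rewrite -def_b; ring.
(* With [n = j.+1], the quadratic factor [p ^ (2 n)] is [p ^ n.+1 * p ^ j], which yields the second
   term of the witness below. *)
have [j def_n] : exists j, n = j.+1 by exists n.-1; rewrite prednK.
apply/dvdzP; exists (b + c * (t : nat)%:Z ^+ 2 * (p ^ j)%N%:Z).
rewrite def_qw -/(multiplier f k w) -/l !PoszD !PoszM def_u.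
rewrite expnS PoszM.
have -> : (p ^ n)%N%:Z = p%:Z * (p ^ j)%N by rewrite def_n expnS PoszM.
ring.
Qed.

Lemma k_gt0 : (0 < k)%N.
Proof. by case/andP: cycC. Qed.

Lemma cycle_sizes_lifted w :
    w \in C ->
  perm_eq (cycle_sizes L)
          [seq (k * d)%N | d <- cycle_sizes (induced [set: 'F_p] (frel (fiber_map w)))].
Proof.
move=> Cw; have [perw defC ordw] := cycle_of_size_orbit cycC Cw.
apply: (perm_cycle_sizes (psi := lift_point w)).
- exact: k_gt0.
- exact: lifted_closed.
- exact: lift_point_inj.
- by move=> t; rewrite inE Zproj_lift_point.
- by move=> t; apply: iter_lift_point.
(* Projecting a return to the fiber gives a return of [w] to itself, and [w] has order [k]. *)
- move=> i t u /(congr1 (Zproj (p ^ n))); rewrite Zproj_iter !Zproj_lift_point => /eqP.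
  by rewrite -periodic_order_dvd // ordw.
(* The projection of [x] reaches [w] along [C], so an iterate of [x] lands above [w]. *)
move=> x; rewrite inE => Cx; have [_ defCx _] := cycle_of_size_orbit cycC Cx.
have := Cw; rewrite {1}defCx inE => /fconnectP[i def_w]; exists i.
by apply: lift_point_surj; rewrite Zproj_iter.
Qed.

(** Both sides reduce the product of the derivative over [C], known modulo [p ^ n], and [p] divides
    [p ^ n]. *)
Lemma multiplier_Fp w w' :
    w \in C -> w' \in C ->
  (multiplier f k w)%:~R = (multiplier f k w')%:~R :> 'F_p.
Proof.
move=> Cw Cw'; apply/eqP; rewrite -subr_eq0 -rmorphB /= Fp_intr_eq0.
apply: (@dvdz_trans (p ^ n)%N); first by rewrite -(prednK n_gt0) expnS PoszM dvdz_mulr.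
by rewrite -Zp_intr_eq // (multiplier_prod cycC Cw) (multiplier_prod cycC Cw').
Qed.

(** A nonzero multiplier makes the fiber map above every vertex of [C] injective on a finite set, so
    each of its points is periodic, and so is every lifted vertex. *)
Lemma partition_lifted w :
    w \in C -> (multiplier f k w)%:~R != 0 :> 'F_p ->
  partition (cycles L) V.
Proof.
move=> Cw l0; apply: partition_cycles => [|x]; first exact: lifted_closed.
rewrite inE; set y := Zproj _ x => Cy; have [t ->] := lift_point_surj (erefl y).
have g_inj : injective (fiber_map y).
  by move=> s u /addrI/mulfI; apply; rewrite (multiplier_Fp Cy Cw).
have : periodic (fiber_map y) t by rewrite /periodic fconnect_f cycle_orbit.
case/periodicP=> q gq; apply/periodicP; exists (q.+1 * k).-1.
rewrite prednK ?muln_gt0 ?k_gt0 // (iter_psi_mul (g := fiber_map y)) ?gq // => s.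
exact: iter_lift_point.
Qed.

End Lifting.

(** * The three cases of the multiplier modulo p *)

Theorem theorem4p3 (p n k : nat) (f : {poly int}) (C : {set 'Z_(p ^ n)})
    (v0 : 'Z_(p ^ n)) :
  prime p -> (1 <= n)%N ->
  cycle_of_size (functional_graph f (N := p ^ n)) k C -> v0 \in C ->
  let lambar : 'F_p := (multiplier f k v0)%:~R in
  let V := lifted_vertices (p ^ n.+1) C in
  let L := lifted_graph f (M := p ^ n.+1) C in
  [/\ lambar = 0 ->
        exists2 D, cycles L = [set D] & cycle_of_size L k D,
      lambar = 1 ->
        (consists_of_cycles V L [:: (k * p)%N]
         \/ consists_of_cycles V L (nseq p k))
        /\ (consists_of_cycles V L (nseq p k)
            <-> exists2 v, v \in C & cycle_rem f p n k v = 0)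
    & lambar <> 0 -> lambar <> 1 ->
        exists2 m, m.-primitive_root lambar
          & consists_of_cycles V L (k :: nseq (p.-1 %/ m) (m * k)%N)].
Proof.
move=> p_pr n_gt0 cycC Cv0 lambar V L.
have sizesL w := @cycle_sizes_lifted p n k f C p_pr n_gt0 cycC w.
have k_pos : (0 < k)%N by case/andP: cycC.
have partL : lambar != 0 -> partition (cycles L) V by apply: partition_lifted Cv0.
(* The left side does not involve [w], so any vertex of [C] may be used to decide between the two
   alternatives. *)
have sizes1 : lambar = 1 -> forall w, w \in C ->
    perm_eq (cycle_sizes L) (if (cycle_rem f p n k w)%:~R == 0 :> 'F_p
                             then nseq p k else [:: (k * p)%N]).
  move=> l1 w Cw; have lw : (multiplier f k w)%:~R = 1 :> 'F_p.
    by rewrite (multiplier_Fp p_pr n_gt0 cycC Cw Cv0).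
  apply: perm_trans (sizesL w Cw) _; case: eqP => [r0|/eqP r0].
    by rewrite cycle_sizes_translation0 // map_nseq muln1.
  by rewrite cycle_sizes_translation.
split.
- move=> l0; have := sizesL v0 Cv0; rewrite cycle_sizes_affine0 //= muln1.
  move=> /(perm_small_eq (s2 := [:: k]) (erefl _)); rewrite /cycle_sizes.
  case def_s: (enum (cycles L)) => [|D []] //= [cardD]; exists D.
    by apply/setP=> E; rewrite in_set1 -mem_enum def_s mem_seq1.
  by have : D \in cycles L by [rewrite -mem_enum def_s mem_head]; rewrite inE cardD.
- move=> l1; have part : partition (cycles L) V by apply: partL; rewrite l1 oner_eq0.
  have p_gt1 := prime_gt1 p_pr.
  split.
    by have := sizes1 l1 v0 Cv0; case: ifP => _ ?; [right | left].
  split=> [[_ sizes]|[v Cv r0]]; last first.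
    by split=> //; have := sizes1 l1 v Cv; rewrite r0 eqxx.
  (* The vertex [v0] itself works: otherwise the single size [k * p] would be a permutation of
     [p > 1] sizes. Being already reduced modulo [p], [cycle_rem] is 0 as an integer once it
     vanishes in ['F_p]. *)
  exists v0 => //; have := sizes1 l1 v0 Cv0; case: ifP => [|_].
    by rewrite Fp_intr_eq0 // /cycle_rem => /dvdz_mod0P; rewrite modz_mod.
  rewrite (permPl sizes) => /perm_size; rewrite size_nseq /= => p1.
  by rewrite p1 in p_gt1.
move=> /eqP l0 /eqP l1.
(* Fermat's little theorem, which provides the order [m] of [lambar]. *)
have unity : lambar ^+ p.-1 = 1.
  apply: (mulfI l0); rewrite mulr1 -exprS prednK ?prime_gt0 //.
  by have := expf_card lambar; rewrite card_Fp.
have [|m prim _] := prim_order_exists _ unity.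
  by rewrite -subn1 subn_gt0 prime_gt1.
exists m => //; split; first exact: partL.
apply: perm_trans (sizesL v0 Cv0) _.
apply: perm_trans (perm_map _ (cycle_sizes_affine _ p_pr prim l1)) _.
by rewrite /= muln1 map_nseq mulnC.
Qed.
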